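(* Let $R \neq 0$ be a directly finite ring. Then $R$ is local if and only if $R$ is $r$-clean and $0$ and $1$ are the only idempotents in $R$.
   Context: All rings are associative with identity (not necessarily commutative). An element $r$ of a ring $R$ is regular (in the sense of von Neumann) if $r = ryr$ for some $y \in R$. An element $x \in R$ is $r$-clean if $x = r + e$ for some regular element $r \in R$ and some idempotent $e \in R$; the ring $R$ is $r$-clean if each of its elements is $r$-clean. A ring $R$ is directly finite if for all $a, b \in R$, $ab = 1$ implies $ba = 1$. *)

(* Defs.v *)
From HB Require Import structures.
From mathcomp Require Import all_boot all_order all_algebra.
From mathcomp Require Import classical_sets.

Set Implicit Arguments.
Unset Strict Implicit.
Unset Printing Implicit Defensive.

Import GRing.Theory.
Local Open Scope ring_scope.
Local Open Scope classical_set_scope.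

Section RingNotions.
Variable R : nzRingType.

Definition is_idempotent (e : R) : Prop := e * e = e.

Definition vn_regular (r : R) : Prop := exists y : R, r = r * y * r.

Definition r_clean_elt (x : R) : Prop :=
  exists r e : R, [/\ vn_regular r, is_idempotent e & x = r + e].

Definition r_clean_ring : Prop := forall x : R, r_clean_elt x.

Definition directly_finite : Prop := forall a b : R, a * b = 1 -> b * a = 1.

(* [ring_quotient.idealr_closed] only covers boolean predicates, so ideals are
   taken here as arbitrary subsets; closure under opposite follows from
   multiplication by [-1]. *)
Definition left_ideal (I : set R) : Prop :=
  [/\ I 0,
      forall x y : R, I x -> I y -> I (x + y)
    & forall a x : R, I x -> I (a * x)].

Definition maximal_left_ideal (I : set R) : Prop :=
  [/\ left_ideal I,
      I <> setT
    & forall J : set R, left_ideal J -> I `<=` J -> J = I \/ J = setT].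

(* For a noncommutative ring this is equivalent to having a unique maximal
   right ideal. *)
Definition local_ring : Prop := exists! m : set R, maximal_left_ideal m.

End RingNotions.

Arguments r_clean_ring R : clear implicits.
Arguments directly_finite R : clear implicits.
Arguments local_ring R : clear implicits.

(* Main.v *)
(** If [m] is the unique maximal left ideal, then by Zorn's lemma every element
    outside [m] is left invertible, hence a unit by direct finiteness; since
    [x] and [x - 1] are not both in [m], [x = x + 0] or [x = (x - 1) + 1] is an
    r-clean decomposition, and likewise an idempotent [e] or its complement
    [1 - e] is a unit.  Conversely, if [x = r + e] with [r = r y r] then [y r]
    is idempotent, so [r = 0] or [r] is left invertible; hence [x] or [1 - x] is
    always left invertible, which makes the elements without left inverse a
    left ideal containing every proper left ideal. *)
Require Import Defs.
From HB Require Import structures.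
From mathcomp Require Import all_boot all_order all_algebra.
From mathcomp Require Import boolp classical_sets.

Import GRing.Theory.
Local Open Scope ring_scope.
Local Open Scope classical_set_scope.

Definition left_invertible {R : nzRingType} (x : R) : Prop :=
  exists y : R, y * x = 1.

Section LeftIdeals.
Context {R : nzRingType}.
Implicit Types (x y e : R) (I J M : set R).

Lemma left_ideal_setT I x :
  left_ideal I -> I x -> left_invertible x -> I = setT.
Proof.
case=> _ _ IM Ix [y yx1]; apply/seteqP; split=> // z _.
by rewrite -[z]mulr1 -yx1 mulrA; apply: IM.
Qed.

Lemma proper_left_ideal1 I : left_ideal I -> I <> setT -> ~ I 1.
Proof.
by move=> lI IT I1; apply/IT/(left_ideal_setT I 1 lI I1); exists 1; rewrite mulr1.
Qed.

Lemma left_ideal_principal x : left_ideal (range (fun a => a * x)).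
Proof.
split; first by exists 0; rewrite ?mul0r.
  by move=> _ _ [a _ <-] [b _ <-]; exists (a + b); rewrite ?mulrDl.
by move=> a _ [b _ <-]; exists (a * b); rewrite ?mulrA.
Qed.

(** Properness is expressed as [~ J 1], which passes to unions of chains, so Zorn's lemma applies to
    the proper left ideals above [I]. *)
Lemma proper_left_ideal_sub_maximal I : left_ideal I -> I <> setT ->
  exists2 M, maximal_left_ideal M & I `<=` M.
Proof.
move=> lI /(proper_left_ideal1 _ lI) I1.
(* The empty set is admitted because [Zorn_bigcup] also ranges over the empty
   chain. *)
pose P := [set J | J = set0 \/ [/\ left_ideal J, I `<=` J & ~ J 1]].
have [|M [PM Mmax]] := @Zorn_bigcup R P.
  move=> F FP totF.
  have FPne J x : F J -> J x -> [/\ left_ideal J, I `<=` J & ~ J 1].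
    by move=> /FP[->|].
  (* A nonempty member [J0] of the chain puts [0] and all of [I] into the union; without one, the
     union is empty. *)
  have [[J0 [FJ0 [x0 J0x0]]]|Fne] := pselect (exists J, F J /\ J !=set0).
    right; have [[J00 _ _] IJ0 _] := FPne _ _ FJ0 J0x0; split.
    - split; first by exists J0.
        move=> x y [J FJ Jx] [K FK Ky].
        have [[_ JD _] _ _] := FPne _ _ FJ Jx.
        have [[_ KD _] _ _] := FPne _ _ FK Ky.
        have [JK|KJ] := totF _ _ FJ FK.
          by exists K => //; apply: KD => //; apply: JK.
        by exists J => //; apply: JD => //; apply: KJ.
      move=> a x [J FJ Jx]; have [[_ _ JM] _ _] := FPne _ _ FJ Jx.
      by exists J => //; apply: JM.
    - by move=> x /IJ0 J0x; exists J0.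
    - by move=> [J FJ J1]; have [_ _] := FPne _ _ FJ J1; apply.
  left; apply/seteqP; split=> // x [J FJ Jx]; apply: Fne.
  by exists J; split=> //; exists x.
have I0 : I 0 by case: lI.
case: PM => [M0|[lM IM M1]].
  (* The empty set is not maximal in [P]: [I] contains [0] and is strictly larger. *)
  exfalso; apply: (Mmax I); last by right; split.
  by rewrite M0; split=> // /(_ _ I0).
exists M => //; split=> //; first by move=> MT; apply: M1; rewrite MT.
move=> J lJ MJ; have [J1|J1] := pselect (J 1).
  by right; apply: (left_ideal_setT J 1 lJ J1); exists 1; rewrite mulr1.
left; apply/seteqP; split=> //; apply: contrapT => nJM.
by apply: (Mmax J) => //; right; split=> // x /IM /MJ.
Qed.

Lemma not_left_invertible_sub_maximal x : ~ left_invertible x ->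
  exists2 M, maximal_left_ideal M & M x.
Proof.
move=> nx; have [|M maxM IM] :=
    proper_left_ideal_sub_maximal _ (left_ideal_principal x).
  move=> xT; apply: nx; have [y _ yx1] : range (fun a => a * x) 1 by rewrite xT.
  by exists y.
by exists M => //; apply: IM; exists 1; rewrite ?mul1r.
Qed.

Lemma local_ring_left_invertible : local_ring R ->
  forall x, left_invertible x \/ left_invertible (1 - x).
Proof.
move=> [m [[lm mT _] uniqm]] x.
have mE y : ~ left_invertible y -> m y.
  by move=> /not_left_invertible_sub_maximal[M /uniqm <-].
have [|/mE mx] := pselect (left_invertible x); first by left.
have [|/mE m1x] := pselect (left_invertible (1 - x)); first by right.
(* Otherwise [m] contains both [1 - x] and [x], hence their sum [1]. *)
case: (proper_left_ideal1 _ lm mT); case: lm => _ mD _.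
by rewrite -(subrK x 1); apply: mD.
Qed.

Lemma left_invertible_local_ring :
  (forall x, left_invertible x \/ left_invertible (1 - x)) -> local_ring R.
Proof.
move=> inv; pose m := [set x : R | ~ left_invertible x].
have inv_mul a x : left_invertible (a * x) -> left_invertible x.
  by move=> [y yax]; exists (y * a); rewrite -mulrA.
have lm : left_ideal m.
  split; first by move=> [y /eqP]; rewrite mulr0 eq_sym oner_eq0.
    move=> x y mx my [u]; rewrite mulrDr => uxy.
    (* As [u * x + u * y = 1], the hypothesis at [u * x] makes [u * x] or [1 - u * x = u * y] left
       invertible, hence [x] or [y]. *)
    have [/inv_mul|] := inv (u * x); first exact: mx.
    by rewrite -uxy addrAC subrr add0r => /inv_mul; apply: my.
  by move=> a x mx /inv_mul.
have mT : m <> setT.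
  move=> mT; have : m 1 by rewrite mT.
  by apply; exists 1; rewrite mulr1.
have sub_m J : left_ideal J -> J <> setT -> J `<=` m.
  by move=> lJ JT x Jx /(left_ideal_setT J x lJ Jx).
exists m; split.
  split=> // J lJ mJ; have [|JT] := pselect (J = setT); first by right.
  by left; apply/seteqP; split=> //; apply: sub_m.
by move=> M [lM MT Mmax]; have [|->|] := Mmax m lm; first exact: sub_m.
Qed.

(** Cancelling [e] on the right in [e * e = 1 * e] needs only a left inverse after rewriting:
    [e = (y * e) * e = y * e = 1]. *)
Lemma left_invertible_idempotent e :
  is_idempotent e -> left_invertible e -> e = 1.
Proof. by move=> ee [y ye1]; rewrite -[e]mul1r -{1}ye1 -mulrA ee. Qed.

Lemma is_idempotentB1 e : is_idempotent e -> is_idempotent (1 - e).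
Proof.
by move=> ee; rewrite /is_idempotent mulrBl mul1r mulrBr mulr1 ee subrr subr0.
Qed.

Lemma left_invertibleN x : left_invertible x -> left_invertible (- x).
Proof. by move=> [y yx1]; exists (- y); rewrite mulrNN. Qed.

Lemma left_invertible_vn_regular x :
  directly_finite R -> left_invertible x -> vn_regular x.
Proof. by move=> fin [y /fin xy1]; exists y; rewrite xy1 mul1r. Qed.

End LeftIdeals.

Theorem corollary4 (R : nzRingType) (hfin : directly_finite R) :
  local_ring R <->
  (r_clean_ring R /\ (forall e : R, is_idempotent e -> e = 0 \/ e = 1)).
Proof.
split=> [/local_ring_left_invertible inv|[clean idem]].
  split=> [x|e ee].
    have [ix|ix] := inv x.
      exists x, 0; split; [|by rewrite /is_idempotent mulr0|by rewrite addr0].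
      exact: left_invertible_vn_regular.
    exists (x - 1), 1; split; [|by rewrite /is_idempotent mulr1|by rewrite subrK].
    apply: left_invertible_vn_regular => //.
    by rewrite -opprB; apply: left_invertibleN.
  have [ie|ie] := inv e; first by right; apply: left_invertible_idempotent.
  left; have e1 := left_invertible_idempotent _ (is_idempotentB1 _ ee) ie.
  by rewrite -[e](subKr 1) e1 subrr.
apply: left_invertible_local_ring => x.
have inv1 : left_invertible (1 : R) by exists 1; rewrite mulr1.
have [r [e [[y ryr] ee ->]]] := clean x.
have yr_idem : is_idempotent (y * r) by rewrite /is_idempotent -mulrA (mulrA r) -ryr.
have [yr0|yr1] := idem _ yr_idem.
  have -> : r = 0 by rewrite ryr -mulrA yr0 mulr0.
  by rewrite add0r; have [->|->] := idem _ ee; [right; rewrite subr0|left].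
(* In the remaining case [y * r = 1], so [y] is a left inverse of [r]. *)
have ir : left_invertible r by exists y.
have [->|->] := idem _ ee; first by left; rewrite addr0.
(* For [e = 1], [1 - (r + 1) = - r]. *)
by right; rewrite opprD addrCA subrr addr0; apply: left_invertibleN.
Qed.
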